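(* Let $V$ be a countable (finite or countably infinite) set. For every $n\in\mathbb{N}$ there exists a natural number $C_2=C_2(n)$, and for every $k\geq C_2$ there exists a natural number $D_{k,n}$, such that for each $k\geq C_2$ the proposition $F\left(V,k,\binom{n}{2}+1\right)$ holds provided $|V|\geq D_{k,n}$.
   Context: For a set $V$ and natural numbers $k,m$, the proposition $F(V,k,m)$ states: for every colouring of the edges of the complete graph on vertex set $V$ using exactly $k$ colours, there is a subset $X\subset V$ such that the edges with both endpoints in $X$ use exactly $m$ distinct colours. *)

(* Defs.v *)
From mathcomp Require Export all_boot.
From mathcomp Require Export boolp classical_sets functions cardinality.

Set Implicit Arguments.
Unset Strict Implicit.
Unset Printing Implicit Defensive.

Local Open Scope classical_set_scope.
Local Open Scope card_scope.

Definition edges (V : Type) (X : set V) : set (set V) :=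
  [set e | e `<=` X /\ e #= `I_2].

(* An edge colouring is given as a function [c : set V -> nat], of which only
   the values on the two-element subsets of [V] matter.  Since the number of
   colours used is finite, there is no loss in taking colours in [nat]. *)
Definition uses_exactly (V : Type) (c : set V -> nat) (X : set V) (m : nat) :
    Prop :=
  c @` edges X #= `I_m.

Definition F (V : Type) (k m : nat) : Prop :=
  forall c : set V -> nat,
    uses_exactly c [set: V] k -> exists X : set V, uses_exactly c X m.

(* Main.v *)
Require Import Defs.
From mathcomp Require Import zify.

(* Let m = 'C(n, 2) + 1; the cases m = 1, 2 are direct, so suppose m >= 4.

   If some vertex v sees many colours, take a set of neighbours joined to v by
   distinct colours and pass to a canonically coloured subset. When that subset
   is monochromatic (use v as well), or its edges are coloured injectively by
   their smaller or by their larger endpoint, every number of colours >= 3 is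
   attained. Otherwise there is a large rainbow clique R. As |V| is huge
   compared with k and |R|, two vertices u, u' outside R have the same colours
   to R. If u is joined in one colour to many vertices of R, then u and n of
   them span m colours; if it is joined in many distinct colours, then u and
   n - 1 vertices of R span a rainbow K_n, and u' adds exactly one colour.

   If every vertex sees few colours, k edges of distinct colours contain a
   large matching for which the four kinds of cross edges are each
   monochromatic. Selecting both endpoints of some matching edges and one
   endpoint of four others gives every number of colours >= 4. *)

Set Implicit Arguments.
Unset Strict Implicit.
Unset Printing Implicit Defensive.

(** * Canonical Ramsey theory for the pairs of a sequence *)

(** Either the class of the head has more than [a] elements, or keeping the head and deleting its
    class costs at most [a.+1] elements; [b] such rounds are affordable. *)
Lemma canonical_pigeonhole (T K : eqType) (f : T -> K) (a b : nat)
    (s : seq T) : a.+1 * b <= size s ->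
  (exists s' d, [/\ subseq s' s, size s' = a.+1
    & {in s', forall x, f x = d}]) \/
  (exists s', [/\ subseq s' s, size s' = b & uniq (map f s')]).
Proof.
elim: b s => [|b IHb] s; first by move=> _; right; exists [::]; rewrite sub0seq.
case: s => [|x s] sz; first by move: sz; rewrite /=; nia.
have [le_a|lt_a] := leqP a.+1 (count (fun y => f y == f x) (x :: s)).
  left; exists (take a.+1 [seq y <- x :: s | f y == f x]), (f x).
  split.
  - exact: subseq_trans (take_subseq _ _) (filter_subseq _ _).
  - by rewrite size_takel // size_filter.
  - by move=> y /mem_take; rewrite mem_filter => /andP[/eqP].
have := IHb [seq y <- x :: s | f y != f x].
rewrite size_filter.
have := count_predC (fun y => f y == f x) (x :: s).
rewrite (eq_count (_ : predC _ =1 (fun y => f y != f x))) // => cnt.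
case; first by move: sz cnt lt_a; nia.
  case=> s' [d [ss' sz' fd]]; left; exists s', d; split=> //.
  exact: subseq_trans ss' (filter_subseq _ _).
case=> s' [ss' sz' us']; right; exists (x :: s'); split;
  rewrite /= ?sz' ?eqxx //.
  move: ss'; rewrite /= eqxx /= => ss'.
  exact: subseq_trans ss' (filter_subseq _ _).
rewrite us' andbT; apply/mapP => -[y /(mem_subseq ss')].
by rewrite mem_filter => /andP[/eqP ne _] eq; case: ne.
Qed.

(** For [Q] equal to [constant], the colour of a pair depends on its earlier element only; for
    [uniq], pairs with the same earlier element differ in colour. *)
Fixpoint fwd (T K : Type) (Q : pred (seq K)) (P : T -> T -> K) (s : seq T) :=
  if s is x :: t then Q (map (P x) t) && fwd Q P t else true.

Lemma subseq_fwd_uniq (T K : eqType) (P : T -> T -> K) (s t : seq T) :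
  subseq s t -> fwd uniq P t -> fwd uniq P s.
Proof.
elim: t s => [|y t IHt] [|x s] //=; case: eqP => [->|_] st /andP[Qy Ht].
  by rewrite (subseq_uniq (map_subseq _ st)) //= (IHt _ st Ht).
exact: IHt st Ht.
Qed.

Lemma fwd_cat (T K : Type) (Q : pred (seq K)) (P : T -> T -> K) (s t : seq T) :
  fwd Q P (s ++ t) -> fwd Q P t.
Proof. by elim: s => //= x s IHs /andP[_ /IHs]. Qed.

(** The last element serves as a probe: the colour that [x] sends forward can be read off at [z],
    which makes it an explicit function of [x]. *)
Lemma fwd_constant_rcons (T K : eqType) (P : T -> T -> K) (s : seq T) (z : T) :
  fwd constant P (rcons s z) -> pairwise (fun x y => P x y == P x z) s.
Proof.
elim: s => //= x s IHs /andP[cx /IHs ->]; rewrite andbT.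
apply/allP => y ys.
have /constantP -/(_ (P x z)) [d dE] := cx.
have inE w : w \in rcons s z -> P x w = d.
  by move=> ws; have := map_f (P x) ws; rewrite dE mem_nseq => /andP[_ /eqP].
by rewrite !inE ?mem_rcons ?in_cons ?ys ?eqxx ?orbT.
Qed.

(** Induction on [a + b] as for Ramsey numbers: the head sends to many later elements either one
    colour, which lowers [a], or pairwise distinct colours, which lowers [b]. *)
Lemma fwd_canonical (a b : nat) : exists N, forall (T K : eqType)
    (P : T -> T -> K) (s : seq T), N <= size s ->
  (exists s', [/\ subseq s' s, size s' = a & fwd constant P s']) \/
  (exists s', [/\ subseq s' s, size s' = b & fwd uniq P s']).
Proof.
move: {2}(a + b) (leqnn (a + b)) => c; elim: c a b => [|c IHc] a b le_c.
  exists 0 => T K P s _; left; exists [::]; split=> //; first exact: sub0seq.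
  by move: le_c => /=; lia.
case: a le_c => [|a] le_c.
  by exists 0 => T K P s _; left; exists [::]; split=> //; exact: sub0seq.
case: b le_c => [|b] le_c.
  by exists 0 => T K P s _; right; exists [::]; split=> //; exact: sub0seq.
have [|N1 HN1] := IHc a b.+1; first lia.
have [|N2 HN2] := IHc a.+1 b; first lia.
exists (N1.+1 * N2).+1 => T K P [|x s] //=; rewrite ltnS => sz.
have tail t : subseq t s -> subseq t (x :: s).
  by move=> ts; exact: subseq_trans ts (subseq_cons s x).
case: (canonical_pigeonhole (P x) sz) =>
  [[s1 [d [ss1 sz1 cs1]]]|[s1 [ss1 sz1 us1]]].
  case: (HN1 T K P s1); first by rewrite sz1.
    case=> s2 [ss2 sz2 f2]; left; exists (x :: s2); split;
      rewrite /= ?eqxx ?sz2 ?f2 ?andbT //.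
      exact: subseq_trans ss2 ss1.
    apply: (@all_pred1_constant _ d); apply/allP => _ /mapP[y ys ->] /=.
    by rewrite cs1 // (mem_subseq ss2).
  case=> s2 [ss2 sz2 f2]; right; exists s2; split=> //.
  exact: tail (subseq_trans ss2 ss1).
case: (HN2 T K P s1); first by rewrite sz1.
  case=> s2 [ss2 sz2 f2]; left; exists s2; split=> //.
  exact: tail (subseq_trans ss2 ss1).
case=> s2 [ss2 sz2 f2]; right; exists (x :: s2); split;
  rewrite /= ?eqxx ?sz2 ?f2 ?andbT //.
  exact: subseq_trans ss2 ss1.
exact: subseq_uniq (map_subseq _ ss2) us1.
Qed.

Lemma pairwise_rev (T : Type) (r : rel T) (s : seq T) :
  pairwise r (rev s) = pairwise (fun x y => r y x) s.
Proof.
by elim: s => //= x s IHs; rewrite rev_cons pairwise_rcons all_rev IHs.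
Qed.

(** A weak form of the Erdős-Rado theorem, obtained by applying [fwd_canonical] forwards and then
    backwards. The last case asks for injectivity only at each vertex in both directions;
    [greedy_rainbow] upgrades it to a rainbow clique. *)
Lemma canonical_ramsey (a : nat) : exists N, forall (T K : eqType)
    (P : T -> T -> K) (s : seq T), N <= size s ->
  exists s', [/\ subseq s' s, size s' = a &
    [\/ exists d, pairwise (fun x y => P x y == d) s',
        exists g, pairwise (fun x y => P x y == g x) s' /\ uniq (map g s'),
        exists h, pairwise (fun x y => P x y == h y) s' /\ uniq (map h s')
      | fwd uniq P s' /\ fwd uniq (fun x y => P y x) (rev s')]].
Proof.
have [N2 HN2] := fwd_canonical a.+1 a.
have [N1 HN1] := fwd_canonical (a.+1 * a).+1 N2.
exists N1 => T K P s /(HN1 _ _ P)[[s1 [ss1 sz1]]|[s1 [ss1 sz1 f1]]].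
  case: (lastP s1) ss1 sz1 => [|s2 z] //;
    rewrite size_rcons => ss1 [sz2] /fwd_constant_rcons f2.
  have ss2 : subseq s2 s by apply: subseq_trans ss1; rewrite -cats1;
    exact: prefix_subseq.
  have := @canonical_pigeonhole _ _ (P ^~ z) a a s2;
    rewrite sz2 => /(_ (leqnn _)).
  case=> [[s3 [d [ss3 sz3 cs3]]]|[s3 [ss3 sz3 us3]]].
    exists (take a s3); have ss4 := subseq_trans (take_subseq s3 a) ss3; split.
    - exact: subseq_trans ss4 ss2.
    - by rewrite size_takel // sz3.
    constructor 1; exists d.
    have := subseq_pairwise ss4 f2; apply: (@sub_in_pairwise _ (mem s3)).
      by move=> x y xs ys /= /eqP ->; rewrite cs3.
    by apply/allP => x /mem_take.
  exists s3; split=> //; first exact: subseq_trans ss3 ss2.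
  constructor 2; exists (P ^~ z); split=> //.
  exact: subseq_pairwise ss3 f2.
have := HN2 T K (fun x y => P y x) (rev s1);
  rewrite size_rev sz1 => /(_ (leqnn _)).
case=> [[s2 [ss2 sz2]]|[s2 [ss2 sz2 f2]]].
  case: (lastP s2) ss2 sz2 => [|s3 z] //;
    rewrite size_rcons => ss2 [sz3] /fwd_constant_rcons f3.
  have ss4 : subseq (z :: rev s3) s1.
    by rewrite -rev_rcons -(revK s1) subseq_rev.
  exists (rev s3); split; rewrite ?size_rev //.
    exact: subseq_trans (subseq_trans (subseq_cons _ z) ss4) ss1.
  (* Here [z] precedes the other vertices in [s1], so forward injectivity at [z] makes [P z]
     injective on them. *)
  constructor 3; exists (P z); split; first by rewrite pairwise_rev.
  by have /= /andP[] := subseq_fwd_uniq ss4 f1.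
have ss3 : subseq (rev s2) s1 by rewrite -(revK s1) subseq_rev.
exists (rev s2); split; rewrite ?size_rev //; first exact: subseq_trans ss3 ss1.
by constructor 4; rewrite revK; split=> //; exact: subseq_fwd_uniq ss3 f1.
Qed.

(** * Colours spanned by a list of vertices *)

(** Multiplicities are kept, so for a duplicate-free [s] the condition [uniq (cols col s)] says that
    [s] is a rainbow clique. *)
Fixpoint cols (T : Type) (col : T -> T -> nat) (s : seq T) : seq nat :=
  if s is x :: t then map (col x) t ++ cols col t else [::].

(** A list version of [exists X, uses_exactly c X m], with [X] finite and the cardinality witnessed
    by the duplicate-free list [L]. *)
Definition spans_exactly (T : eqType) (col : T -> T -> nat) (m : nat) :=
  exists (s : seq T) (L : seq nat), [/\ uniq L, size L = m &
    forall d, d \in L <->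
      exists x y, [/\ x \in s, y \in s, x != y & col x y = d]].

Lemma size_cols (T : Type) (col : T -> T -> nat) (s : seq T) :
  size (cols col s) = 'C(size s, 2).
Proof.
by elim: s => //= x s IHs; rewrite size_cat size_map IHs binS bin1 addnC.
Qed.

Lemma mem_cols (T : eqType) (col : T -> T -> nat) (s : seq T) (d : nat) :
  commutative col -> uniq s -> d \in cols col s <->
  exists x y, [/\ x \in s, y \in s, x != y & col x y = d].
Proof.
move=> colC; elim: s => [|z s IHs] /=; first by split=> // -[x [y []]].
case/andP=> zs /IHs {}IHs; rewrite mem_cat; split.
  case/orP=> [/mapP[y ys ->]|/IHs[x [y [xs ys xy <-]]]].
    exists z, y; rewrite !in_cons eqxx ys orbT; split=> //.
    by apply: contraNneq zs => ->.
  by exists x, y; rewrite !in_cons xs ys !orbT.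
case=> x [y []]; rewrite !in_cons.
case: (eqVneq x z) => [->|xz] /=; case: (eqVneq y z) => [->|yz] //=.
- by move=> _ ys _ <-; rewrite map_f.
- by move=> xs _ _ <-; rewrite colC map_f.
- by move=> xs ys xy E; apply/orP; right; apply/IHs; exists x, y.
Qed.

Lemma pairwise_mem (T : eqType) (r : rel T) (s : seq T) (x y : T) :
  pairwise r s -> x \in s -> y \in s -> x != y -> r x y || r y x.
Proof.
elim: s => //= z s IHs /andP[/allP rz /IHs {}IHs]; rewrite !in_cons.
case: (eqVneq x z) => [->|xz] /=; case: (eqVneq y z) => [->|yz] //=.
- by move=> _ /rz ->.
- by move=> /rz ->; rewrite orbT.
Qed.

Lemma uniq_cols_fwd (T : eqType) (col : T -> T -> nat) (s : seq T) :
  uniq (cols col s) -> fwd uniq col s.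
Proof. by elim: s => //= x s IHs; rewrite cat_uniq => /and3P[-> _ /IHs]. Qed.

Lemma subseq_cols (T : eqType) (col : T -> T -> nat) (s t : seq T) :
  subseq s t -> subseq (cols col s) (cols col t).
Proof.
elim: t s => [|y t IHt] [|x s] //= ; rewrite ?sub0seq //.
case: eqP => [->|_] st; first by rewrite cat_subseq ?map_subseq ?IHt.
exact: subseq_trans (IHt _ st) (suffix_subseq _ _).
Qed.

Lemma perm_cols_rev (T : eqType) (col : T -> T -> nat) (s : seq T) :
  commutative col -> perm_eq (cols col (rev s)) (cols col s).
Proof.
move=> colC; elim: s => //= x s IHs; rewrite rev_cons.
have colsS t : perm_eq (cols col (rcons t x)) (map (col x) t ++ cols col t).
  elim: t => //= y t IHt; apply/permP => p; move: (permP IHt p).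
  by rewrite map_rcons -!cats1 !count_cat /= !count_cat (colC x y) /=; lia.
apply: perm_trans (colsS _) _.
by rewrite perm_cat ?IHs // perm_map // perm_rev.
Qed.

Lemma uniq_cols_rev (T : eqType) (col : T -> T -> nat) (s : seq T) :
  commutative col -> uniq (cols col (rev s)) = uniq (cols col s).
Proof. by move=> colC; rewrite (perm_uniq (perm_cols_rev _ colC)). Qed.

(** * Extraction of rainbow cliques *)

(** Each [x] in [S] sends distinct colours to [w], so it hits each colour of [G] at most once. *)
Lemma count_bad (T : eqType) (col : T -> T -> nat) (S w : seq T)
    (G : seq nat) : {in S, forall x, uniq (map (col x) w)} ->
  count (fun y => has (fun x => col x y \in G) S) w <= size S * size G.
Proof.
elim: S => [|x S IHS] uS;
  first by rewrite (eq_count (a2 := pred0)) ?count_pred0.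
have /IHS {}IHS : {in S, forall x, uniq (map (col x) w)}.
  by move=> y yS; apply: uS; rewrite in_cons yS orbT.
rewrite [size (_ :: _)]/= mulSn.
set A := fun y => col x y \in G; set B := fun y => has _ S in IHS.
rewrite (eq_count (_ : _ =1 predU A B)) //.
have := count_predUI A B w.
have : count A w <= size G.
  rewrite -(count_map (col x) (mem G)) -size_filter; apply: uniq_leq_size.
    by rewrite filter_uniq ?uS ?mem_head.
  by move=> d; rewrite mem_filter => /andP[].
by lia.
Qed.

(* Scanning [w] from the left and dropping each vertex that would repeat a
   colour; forward injectivity bounds how many vertices are dropped. *)
Lemma greedy_rainbow (a p q : nat) : exists N, forall (T : eqType)
    (col : T -> T -> nat) (S w : seq T) (F : seq nat),
  commutative col -> N <= size w -> size S = p -> size F = q ->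
  uniq (w ++ S) -> uniq (cols col S ++ F) ->
  fwd uniq col w -> fwd uniq col (rev w ++ S) ->
  {in S, forall x, uniq (map (col x) w)} ->
  exists w', [/\ size w' = a, {subset w' <= w}, uniq (w' ++ S)
    & uniq (cols col (w' ++ S) ++ F)].
Proof.
elim: a p => [|a IHa] p.
  exists 0 => T col S w F _ _ _ _ uwS uSF _ _ _; exists [::]; split=> //.
  by move: uwS; rewrite cat_uniq => /and3P[].
have [N HN] := IHa p.+1.
(* [S] holds the vertices already kept and [F] the colours to avoid. By [count_bad] at most
   [p * ('C(p, 2) + q)] vertices repeat a colour; one good vertex is kept and [N] others remain for
   the induction. *)
exists (N + p * ('C(p, 2) + q)).+1 =>
  T col S w F colC szw szS szF uwS uSF fw bw Sw.
pose bad y := has (fun x => col x y \in cols col S ++ F) S.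
have := count_bad (cols col S ++ F) Sw.
rewrite -/bad size_cat size_cols szS szF => le_bad.
have := count_predC bad w; rewrite -(size_filter (predC bad)).
have : subseq (filter (predC bad) w) w by exact: filter_subseq.
have : {in filter (predC bad) w, forall y, ~~ bad y}.
  by move=> y; rewrite mem_filter => /andP[].
case: (filter _ w) => [|y w2] good sub sz; first by move: sz szw le_bad => /=;
  lia.
have sub2 : subseq w2 w by exact: subseq_trans (subseq_cons _ _) sub.
have fw2 := subseq_fwd_uniq sub fw.
(* Reading backwards, the kept vertices come last; injectivity in this direction gives [y] distinct
   colours to [S]. *)
have bw2 : fwd uniq col (rev w2 ++ y :: S).
  rewrite -cat_rcons -rev_cons; apply: subseq_fwd_uniq bw.
  by rewrite cat_subseq // subseq_rev.
have /= /andP[uyS _] := fwd_cat bw2.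
have uwS2 : uniq (w2 ++ y :: S).
  rewrite (perm_uniq (s2 := (y :: w2) ++ S)).
    by apply: subseq_uniq uwS; rewrite cat_subseq.
  by rewrite -cat1s perm_catCA.
case: (HN T col (y :: S) w2 F) => //.
- by move: sz szw le_bad => /=; lia.
- by rewrite /= szS.
- rewrite /= -catA cat_uniq uyS uSF andbT /=.
  apply/hasPn => d dG; apply/mapP => -[x xS dE].
  have /hasPn/(_ x xS) := good y (mem_head _ _).
  by rewrite colC -dE dG.
- by move: fw2 => /= /andP[].
- move=> x; rewrite in_cons => /predU1P[->|xS];
    first by move: fw2 => /= /andP[].
  exact: subseq_uniq (map_subseq _ sub2) (Sw _ xS).
move=> w3 [sz3 sub3 u3 uc3]; exists (rcons w3 y);
  rewrite size_rcons sz3 cat_rcons.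
split=> // x; rewrite mem_rcons in_cons => /predU1P[->|/sub3 xw2].
  exact: mem_subseq sub _ (mem_head _ _).
exact: mem_subseq sub2 _ xw2.
Qed.

(** * A star with many colours *)

(** Among the first [m.+1] vertices the last is never the earlier endpoint, so the colours are the
    [m] values of [g] on the others. *)
Lemma min_colouring_spans (T : eqType) (col : T -> T -> nat) (g : T -> nat)
    (s : seq T) (m : nat) : commutative col -> m < size s ->
  pairwise (fun x y => col x y == g x) s -> uniq (map g s) ->
  spans_exactly col m.
Proof.
move=> colC sz ps us.
have sub : subseq (take m.+1 s) s by exact: take_subseq.
move: (subseq_pairwise sub ps) (subseq_uniq (map_subseq g sub) us) (size_takel
  sz).
case/lastP: (take _ s) => // {ps us sub sz}s z.
rewrite size_rcons => ps us [sz]; exists (rcons s z), (map g s).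
move: us; rewrite map_rcons rcons_uniq => /andP[gz us].
have zs : z \notin s by apply: contra gz; exact: map_f.
split; rewrite ?size_map // => d; split.
  case/mapP=> x xs ->; exists x, z; rewrite !mem_rcons !in_cons xs eqxx orbT.
  split=> //; first by apply: contraNneq zs => <-.
  by move: ps; rewrite pairwise_rcons => /andP[/allP/(_ x xs)/eqP].
move: ps; rewrite pairwise_rcons => /andP[/allP gz' ps].
case=> x [y [+ + xy <-]]; rewrite !mem_rcons !in_cons.
case: (eqVneq x z) xy => [->|xz] xy; case: (eqVneq y z) xy => [->|yz] xy //=.
- by move=> _ ys; rewrite colC (eqP (gz' _ ys)) map_f.
- by move=> xs _; rewrite (eqP (gz' _ xs)) map_f.
- move=> xs ys; case/orP: (pairwise_mem ps xs ys xy) => /eqP E.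
    by rewrite E map_f.
  by rewrite colC E map_f.
Qed.

(** At most one vertex of [s] is joined to [v] in colour [d]. With [v], [m.-1] of the others show
    [m.-1] star colours and also [d], since [m.-1] is at least 2. *)
Lemma mono_star_spans (T : eqType) (col : T -> T -> nat) (v : T) (d : nat)
    (s : seq T) (m : nat) : 2 < m -> commutative col -> m <= size s ->
  v \notin s -> uniq (map (col v) s) ->
  pairwise (fun x y => col x y == d) s -> spans_exactly col m.
Proof.
move=> m2 colC sz vs us ps.
pose t := take m.-1 [seq x <- s | col v x != d].
have tnd x : x \in t -> col v x != d.
  by move/mem_take; rewrite mem_filter => /andP[].
have sub : subseq t s by exact: subseq_trans (take_subseq _ _) (filter_subseq _
  _).
have szt : size t = m.-1.
  rewrite size_takel // size_filter.
  have := count_predC (fun x => col v x == d) s.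
  rewrite (eq_count (_ : predC _ =1 (fun x => col v x != d))) //.
  have := count_uniq_mem d us; rewrite count_map /preim /= => ->.
  by case: (_ \in _) => /=; lia.
have {}us := subseq_uniq (map_subseq _ sub) us.
have {}ps := subseq_pairwise sub ps.
have vt : v \notin t by apply: contra vs; exact: mem_subseq.
exists (v :: t), (d :: map (col v) t); split.
- rewrite /= us andbT; apply/mapP => -[x xt E].
  by have := tnd x xt; rewrite -E eqxx.
- by rewrite /= size_map szt; lia.
- move=> e; rewrite in_cons; split.
    case/predU1P => [->|/mapP[x xt ->]]; last first.
      exists v, x; rewrite !in_cons xt eqxx orbT; split=> //.
      by apply: contraNneq vt => ->.
    case: t szt us ps {tnd vt sub} => [|x [|y t]]; try by move=> /=; lia.
    move=> _ u /andP[/= /andP[/eqP <- _] _]; exists x, y.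
    rewrite !in_cons !eqxx !orbT; split=> //.
    by move: (map_uniq u) => /= /andP[]; rewrite in_cons negb_or => /andP[].
  case=> x [y [+ + xy <-]]; rewrite !in_cons.
  case: (eqVneq x v) xy => [->|xv] xy; case: (eqVneq y v) xy => [->|yv] xy //=.
  + by move=> _ yt; rewrite map_f ?orbT.
  + by move=> xt _; rewrite colC map_f ?orbT.
  + move=> xt yt; case/orP: (pairwise_mem ps xt yt xy) => /eqP E.
      by rewrite E eqxx.
    by rewrite colC E eqxx.
Qed.

Lemma star_spans (m r : nat) : 2 < m -> exists N, forall (T : eqType)
    (col : T -> T -> nat) (v : T) (xs : seq T), commutative col ->
  N <= size xs -> v \notin xs -> uniq (map (col v) xs) ->
  spans_exactly col m \/
  exists R, [/\ size R = r, uniq R & uniq (cols col R)].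
Proof.
move=> m2.
have [N1 HN1] := greedy_rainbow r 0 0.
have [N2 HN2] := canonical_ramsey (N1 + m.+1).
exists N2 => T col v xs colC /(HN2 _ _ col)[s [ss szs cases]] vxs uxs.
have us : uniq s by exact: subseq_uniq ss (map_uniq uxs).
have vs : v \notin s by apply: contra vxs; exact: mem_subseq.
have {ss}uvs := subseq_uniq (map_subseq (col v) ss) uxs.
case: cases => [[d ps]|[g [ps ug]]|[h [ps uh]]|[fs bs]].
- left; apply: (mono_star_spans m2 colC _ vs uvs ps); rewrite szs; lia.
- by left; apply: (min_colouring_spans colC _ ps ug); rewrite szs; lia.
(* Reversal turns a colouring by later endpoints into one by earlier endpoints. *)
- left; apply: (@min_colouring_spans _ _ h (rev s));
    rewrite ?size_rev ?map_rev ?rev_uniq //.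
    by rewrite szs; lia.
  by rewrite pairwise_rev; apply: sub_pairwise ps => x y; rewrite colC.
right; case: (HN1 T col [::] s [::]); rewrite ?cats0 //.
- by rewrite szs; lia.
- have -> // : fwd uniq col (rev s) = fwd uniq (fun x y => col y x) (rev s).
  by congr fwd; apply/funext => x; apply/funext => y; rewrite colC.
by move=> R [szR _]; rewrite !cats0 => uR ucR; exists R.
Qed.

(** * A large rainbow clique with two twin vertices *)

Lemma uniq_map_bool (T : eqType) (g : T -> bool) (s : seq T) :
  uniq (map g s) -> size s <= 2.
Proof.
move=> us; rewrite -(size_map g).
by rewrite -[2]/(size [:: true; false]) uniq_leq_size // => -[].
Qed.

Lemma boolean_ramsey (a : nat) : exists N, forall (T : eqType)
    (P : T -> T -> bool) (s : seq T), N <= size s ->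
  exists s' d, [/\ subseq s' s, size s' = a & pairwise (fun x y =>
    P x y == d) s'].
Proof.
(* At most two elements have distinct Boolean values, so only the monochromatic case survives. The
   last case controls just the elements after the head, and three of them are needed for a
   contradiction. *)
have [N HN] := canonical_ramsey (a + 4).
exists N => T P s /(HN _ _ P)[s' [ss sz]].
have sub : subseq (take a s') s by exact: subseq_trans (take_subseq _ _) ss.
case=> [[d ps]|[g [_ /uniq_map_bool]]|[h [_ /uniq_map_bool]]|[+ _]]; last first.
- case: s' sz {ss sub} => [|x s'] /=; first by lia.
  by move=> sz /andP[/uniq_map_bool]; lia.
- by rewrite sz; lia.
- by rewrite sz; lia.
exists (take a s'), d; split=> //; first by rewrite size_takel // sz; lia.
exact: subseq_pairwise (take_subseq _ _) ps.
Qed.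

Lemma fwd_uniq_rcons (T : eqType) (col : T -> T -> nat) (u : T) (s : seq T) :
  fwd uniq col s -> pairwise (fun y x => col y x != col y u) s ->
  fwd uniq col (rcons s u).
Proof.
elim: s => //= y s IHs /andP[uy /IHs {}IHs] /andP[/allP ny /IHs ->].
rewrite map_rcons rcons_uniq uy !andbT; apply/mapP => -[x xs E].
by have := ny x xs; rewrite -E eqxx.
Qed.

Lemma rainbow_clique_spans (n : nat) : exists r, forall (T : eqType)
    (col : T -> T -> nat) (R : seq T) (u u' : T), commutative col ->
  r <= size R -> uniq R -> uniq (cols col R) -> u \notin R -> u' \notin R ->
  u != u' -> {in R, forall x, col u x = col u' x} ->
  spans_exactly col ('C(n.+1, 2) + 1).
Proof.
(* Each selection avoids one colour, the one that will be added to the rainbow clique: the common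
   colour [d] from [u], or [col u u']. *)
have [A HA] := greedy_rainbow n.+1 0 1.
have [B HB] := greedy_rainbow n 1 1.
have [M HM] := boolean_ramsey (B + 3).
exists (A.+1 * M) => T col R u u' colC szR uR ucR uNR u'NR uu' twin.
case: (canonical_pigeonhole (col u) szR) =>
  [[s [d [ss szs cd]]]|[s [ss szs us]]].
  have uss := subseq_uniq ss uR.
  have ucs := subseq_uniq (subseq_cols col ss) ucR.
  case: (HA T col [::] s [:: d]); rewrite ?cats0 //.
  - by rewrite szs.
  - exact: uniq_cols_fwd.
  - by rewrite uniq_cols_fwd // uniq_cols_rev.
  move=> w [szw sw]; rewrite !cats0 cats1 rcons_uniq => uw /andP[dw ucw].
  have uNw : u \notin w by apply: contra uNR => /sw; exact: mem_subseq.
  exists (u :: w), (d :: cols col w); split; first by rewrite /= dw.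
    by rewrite /= size_cols szw addn1.
  move=> e; rewrite -(@mem_cols _ _ (u :: w)) /= ?uNw // mem_cat in_cons.
  have -> // : e == d = (e \in [seq col u i | i <- w]).
  apply/eqP/mapP => [->|[x /sw /cd <-] //].
  case: w szw sw {uw dw ucw uNw} => // x w _ sw; exists x; rewrite ?mem_head //.
  by rewrite cd // sw ?mem_head.
(* The edges from [u] differ among themselves but may repeat colours inside [s]; this relation marks
   the repetitions that would obstruct the greedy selection. *)
have := HM _ (fun x y => col x y == col u y) s; rewrite szs => /(_ (leqnn _)).
case=> t [b [st szt pt]].
have sR := subseq_trans st ss.
have ut := subseq_uniq sR uR; have uct := subseq_uniq (subseq_cols col sR) ucR.
have but := subseq_uniq (map_subseq _ st) us.
(* The value [true] would give [col x z = col u z = col y z] for three successive vertices [x], [y],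
   [z], against the rainbow hypothesis; hence the [+ 3] above. *)
have {b}pt : pairwise (fun x y => col x y != col u y) t.
  case: b pt; last by apply: sub_pairwise => x y /eqP ->.
  case: t szt uct {st sR ut but} => [|x [|y [|z t]]]; rewrite addn3 //.
  move=> _ uc /= /and3P[/and3P[_ /eqP/eqP xz _] /andP[/eqP/eqP yz _] _].
  by move: uc => /= /and3P[_]; rewrite mem_cat in_cons xz yz eqxx orbT.
have uNt : u \notin t by apply: contra uNR; exact: mem_subseq.
case: (HB T col [:: u] t [:: col u u']) => //.
- by rewrite szt leq_addr.
- by rewrite cats1 rcons_uniq uNt ut.
- exact: uniq_cols_fwd.
- rewrite cats1; apply: fwd_uniq_rcons;
    first by rewrite uniq_cols_fwd // uniq_cols_rev.
  rewrite pairwise_rev; apply: sub_pairwise pt => x y.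
  by rewrite colC (colC u).
- by move=> x; rewrite inE => /eqP ->.
move=> w [szw sw]; rewrite !cats1 !rcons_uniq => /andP[uNw uw] /andP[dw ucw].
(* As a twin, [u'] repeats on [w] the colours of [u], so its only new colour is [col u u']. *)
exists (u' :: rcons w u), (col u u' :: cols col (rcons w u)).
have swR x : x \in w -> x \in R by move=> /sw; exact: mem_subseq.
have u'Nw : u' \notin w by apply: contra u'NR => /swR.
have uuw : uniq (u' :: rcons w u).
  by rewrite /= mem_rcons in_cons rcons_uniq negb_or eq_sym uu' u'Nw uNw uw.
split; first by rewrite /= dw.
  by rewrite /= size_cols size_rcons szw addn1.
move=> e; rewrite -mem_cols //= mem_cat in_cons map_rcons mem_rcons in_cons.
rewrite (colC u' u); split; first by case/orP => ->; rewrite ?orbT.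
case/orP => [/predU1P[->|/mapP[x xw ->]]|->]; rewrite ?eqxx ?orbT //.
rewrite -twin ?swR //; apply/orP; right; apply/mem_cols => //.
  by rewrite rcons_uniq uNw uw.
exists u, x; rewrite !mem_rcons !in_cons xw eqxx orbT; split=> //.
by apply: contraNneq uNw => ->.
Qed.

(** The vertices of [R] are treated one at a time. As [k.+1] distinct colours cannot occur, the
    pigeonhole always yields a large part of [U] on which [col x] is constant. *)
Lemma twins (r k a : nat) : exists N, forall (T : eqType)
    (col : T -> T -> nat) (R U : seq T) (L : seq nat),
  size R = r -> size L = k -> N <= size U ->
  {in R & U, forall x u, col x u \in L} ->
  exists U', [/\ subseq U' U, size U' = a
    & {in R & U' &, forall x u u', col x u = col x u'}].
Proof.
elim: r => [|r [N HN]].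
  exists a => T col R U L /size0nil -> _ sz _; exists (take a U).
  by split; rewrite ?take_subseq ?size_takel.
exists (N.+1 * k.+1) => T col [|x R] // U L [szR] szL szU colL.
case: (canonical_pigeonhole (col x) szU) =>
  [[U1 [d [sU1 szU1 cU1]]]|[U1 [sU1 szU1 uU1]]].
  case: (HN T col R U1 L) => //.
  - by rewrite szU1.
  - move=> y u yR uU; apply: colL; first by rewrite in_cons yR orbT.
    exact: mem_subseq sU1 _ uU.
  move=> U2 [sU2 szU2 cU2]; exists U2; split=> //;
    first exact: subseq_trans sU2 sU1.
  move=> y u u'; rewrite in_cons => /predU1P[->|yR] uU u'U; last exact: cU2.
  by rewrite !cU1 // (mem_subseq sU2).
have : size (map (col x) U1) <= size L.
  apply: uniq_leq_size => // _ /mapP[u uU ->]; apply: colL;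
    rewrite ?mem_head //.
  exact: mem_subseq sU1 _ uU.
by rewrite size_map szU1 szL ltnn.
Qed.

(** * Stars with few colours: homogeneous matchings *)

Lemma uniq_map_pair (T K1 K2 : eqType) (f : T -> K1) (g : T -> K2) (a : nat)
    (s : seq T) : a.+1 * a <= size s -> uniq (map (fun x => (f x, g x)) s) ->
  exists s', [/\ subseq s' s, a <= size s' & uniq (map f s') \/ uniq (map g
    s')].
Proof.
move=> sz us.
case: (canonical_pigeonhole f sz) => [[s' [d [ss szs' fd]]]|[s' [ss szs' uf]]].
  exists s'; split; rewrite ?szs' //; right.
  have := subseq_uniq (map_subseq _ ss) us.
  rewrite (iffLR (eq_in_map _ (fun x => (d, g x)) _)); last by move=> x /fd ->.
  by rewrite (map_comp (pair d) g) => /map_uniq.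
by exists s'; split; rewrite ?szs' //; left.
Qed.

(* The colouring extended to the diagonal by a colour used nowhere else. *)
Definition ecol (T : eqType) (col : T -> T -> nat) (x y : T) : nat :=
  if x == y then 0 else (col x y).+1.

Lemma ecolC (T : eqType) (col : T -> T -> nat) :
  commutative col -> commutative (ecol col).
Proof. by move=> colC x y; rewrite /ecol eq_sym colC. Qed.

Lemma ecol_star_bound (T : eqType) (col : T -> T -> nat) (v : T) (N : nat) :
  (forall xs, v \notin xs -> uniq (map (col v) xs) -> size xs <= N) ->
  forall xs, uniq (map (ecol col v) xs) -> size xs <= N.+1.
Proof.
move=> bound xs us.
have : size (filter (predC1 v) xs) <= N.
  apply: bound; first by rewrite mem_filter /= eqxx.
  have := subseq_uniq (map_subseq _ (filter_subseq (predC1 v) xs)) us.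
  rewrite (iffLR (eq_in_map (ecol col v) (fun x => (col v x).+1) _));
    last first.
    by move=> x; rewrite mem_filter /= => /andP[xv _];
      rewrite /ecol eq_sym (negPf xv).
  by rewrite (map_comp S (col v)) => /map_uniq.
have := count_predC (pred1 v) xs.
rewrite size_filter (eq_count (_ : predC _ =1 predC1 v)) //.
by rewrite (count_uniq_mem _ (map_uniq us)); case: (v \in xs) => /=; lia.
Qed.

(** Edges of the list may share endpoints, hence [ecol]: an entry 0 records a coincidence. *)
Definition cross (T : eqType) (col : T -> T -> nat) (p q : T * T) :=
  ((ecol col p.1 q.1, ecol col p.1 q.2), (ecol col p.2 q.1, ecol col p.2 q.2)).

Definition edge_col (T : Type) (col : T -> T -> nat) (p : T * T) : nat :=
  col p.1 p.2.

(** In each case of [canonical_ramsey] other than the monochromatic one, a fixed pair [z] has many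
    distinct values of [cross] with other pairs. One of the four coordinates then takes many values,
    which gives a star with too many colours at an endpoint of [z]. *)
Lemma homogeneous_matching (a N : nat) : exists M, forall (T : eqType)
    (col : T -> T -> nat) (ps : seq (T * T)), commutative col ->
  (forall v xs, v \notin xs -> uniq (map (col v) xs) -> size xs <= N) ->
  M <= size ps ->
  exists s d, [/\ subseq s ps, size s = a & pairwise (fun p q =>
    cross col p q == d) s].
Proof.
(* Two uses of [uniq_map_pair] reduce quadruples to single coordinates and leave [N.+2] distinct
   colours, one above the star bound for [ecol]. *)
pose A1 := N.+3 * N.+2; pose A2 := A1.+1 * A1.
have [M HM] := canonical_ramsey (a + A2.+1).
exists M => T col ps colC bound /(HM _ _ (cross col))[s [ss szs]].
have {}bound v xs := @ecol_star_bound T col v N (bound v) xs.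
have quad (f1 f2 f3 f4 : T * T -> nat) s' : A2 <= size s' ->
    (forall t, uniq (map f1 t) -> size t <= N.+1) ->
    (forall t, uniq (map f2 t) -> size t <= N.+1) ->
    (forall t, uniq (map f3 t) -> size t <= N.+1) ->
    (forall t, uniq (map f4 t) -> size t <= N.+1) ->
    ~~ uniq (map (fun q => ((f1 q, f2 q), (f3 q, f4 q))) s').
  move=> sz b1 b2 b3 b4; apply/negP => /(uniq_map_pair sz)[t [_ szt]].
  by case=> /(uniq_map_pair (a := N.+2) szt)[t' [_ szt' []]] =>
    [/b1|/b2|/b3|/b4]; rewrite leqNgt szt'.
have bnd v (pi : T * T -> T) (t : seq (T * T)) :
    uniq (map (fun q => ecol col v (pi q)) t) -> size t <= N.+1.
  by rewrite (map_comp (ecol col v) pi) => /bound; rewrite size_map.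
have fwd_star z t : A2 <= size t -> ~~ uniq (map (cross col z) t).
  by move=> szt; apply: quad szt _ _ _ _ => t'; exact: bnd.
have bwd_star z t : A2 <= size t -> ~~ uniq (map ((cross col)^~ z) t).
  move=> szt; rewrite /cross.
  under eq_map do rewrite !(ecolC colC _ z.1) !(ecolC colC _ z.2).
  by apply: quad szt _ _ _ _ => t'; exact: bnd.
case=> [[d ps']|[g [pg ug]]|[h [ph uh]]|[fs _]].
- exists (take a s), d; split.
  + exact: subseq_trans (take_subseq _ _) ss.
  + by rewrite size_takel // szs leq_addr.
  + exact: subseq_pairwise (take_subseq _ _) ps'.
- case/lastP: s szs pg ug {ss} => [|s z]; rewrite addnS // size_rcons => -[szs].
  rewrite pairwise_rcons map_rcons rcons_uniq => /andP[/allP gz _] /andP[_ ug].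
  have sz1 : A2 <= size s by rewrite szs leq_addl.
  case/negP: (bwd_star z s sz1).
  by rewrite (iffLR (eq_in_map _ g _)) // => x /gz/eqP.
- case: s szs ph uh {ss} => [|z s]; rewrite addnS //= => -[szs].
  move=> /andP[/allP hz _] /andP[_ uh].
  have sz1 : A2 <= size s by rewrite szs leq_addl.
  case/negP: (fwd_star z s sz1).
  by rewrite (iffLR (eq_in_map _ h _)) // => x /hz/eqP.
- case: s szs fs {ss} => [|z s]; rewrite addnS //= => -[szs] /andP[uz _].
  have sz1 : A2 <= size s by rewrite szs leq_addl.
  by case/negP: (fwd_star z s sz1).
Qed.

(** The other endpoints would form a star at [v] with more than [N] colours. Taking [f] and [g] to
    be the projections in either order covers both endpoints. *)
Lemma no_common_vertex (T : eqType) (col : T -> T -> nat) (N : nat) (v : T)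
    (f g : T * T -> T) (s : seq (T * T)) :
  (forall v xs, v \notin xs -> uniq (map (col v) xs) -> size xs <= N) ->
  {in s, forall p, f p != g p} ->
    {in s, forall p, col (f p) (g p) = edge_col col p} ->
  uniq (map (edge_col col) s) -> N < size s -> {in s, forall p, f p = v} ->
    False.
Proof.
move=> bound fg fgE us sz fv.
have vg : v \notin map g s.
  by apply/mapP => -[p ps E]; have := fg p ps; rewrite fv // E eqxx.
have uv : uniq (map (col v) (map g s)).
  rewrite -map_comp (iffLR (eq_in_map _ (edge_col col) _)) // => p ps /=.
  by rewrite -fgE // fv.
by have := bound _ _ vg uv; rewrite size_map leqNgt sz.
Qed.

(** Successor entries make the pairs vertex-disjoint. The colours seen are the cross colours and the
    own colours of the fully selected pairs. Of the 8 spare pairs, 4 allow for own colours in [Ty]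
    and 4 supply single endpoints. *)
Lemma homogeneous_matching_spans (T : eqType) (col : T -> T -> nat) (m : nat)
    (al be ga de : nat) (s : seq (T * T)) :
  3 < m -> commutative col -> m + 8 <= size s ->
  uniq (map (edge_col col) s) -> {in s, forall p, p.1 != p.2} ->
  pairwise (fun p q => cross col p q == ((al.+1, be.+1), (ga.+1, de.+1))) s ->
  spans_exactly col m.
Proof.
move=> m3 colC szs us ns ps.
pose Ty := [:: al; be; ga; de].
pose vtx (pb : (T * T) * bool) := if pb.2 then pb.1.1 else pb.1.2.
have tyE x y e : ecol col x y = e.+1 -> x != y /\ col x y = e.
  by rewrite /ecol; case: eqP => // _ [].
have {}ps : pairwise (fun p q => [forall b, forall b',
    (vtx (p, b) != vtx (q, b')) && (col (vtx (p, b)) (vtx (q, b')) ==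
      if b then (if b' then al else be) else (if b' then ga else de))]) s.
  apply: sub_pairwise ps =>
    p q /eqP[/tyE[? E1] /tyE[? E2] /tyE[? E3] /tyE[? E4]].
  apply/forallP => b; apply/forallP => b'; rewrite /vtx /=.
  by case: b b' => -[]; apply/andP; split=> //; rewrite ?E1 ?E2 ?E3 ?E4.
have [t [st szt nTy]] : exists t, [/\ subseq t s, m + 4 <= size t
    & {in t, forall p, edge_col col p \notin Ty}].
  exists [seq p <- s | edge_col col p \notin Ty]; split.
  - exact: filter_subseq.
  - have : size [seq d <- map (edge_col col) s | d \in Ty] <= size Ty.
      by apply: uniq_leq_size => [|d];
        rewrite ?filter_uniq // mem_filter => /andP[].
    rewrite !size_filter count_map; set A := preim _ _.
    have := count_predC A s.
    rewrite (eq_count (_ : predC A =1 (fun p => edge_col col p \notin Ty))) //.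
    by rewrite [size Ty]/=; lia.
  - by move=> p; rewrite mem_filter => /andP[].
have {ps}pt := subseq_pairwise st ps.
have {us}ut := subseq_uniq (map_subseq _ st) us.
have {ns}nt p : p \in t -> p.1 != p.2 by move/(mem_subseq st); exact: ns.
have [U [uU memU szU]] : exists U, [/\ uniq U, U =i Ty & size U <= 4].
  by exists (undup Ty); rewrite undup_uniq size_undup; split=> // d;
    rewrite mem_undup.
(* Coincidences among the cross colours are compensated by more full pairs; the subtraction is exact
   because [size U <= 4 <= m]. *)
pose j := m - size U.
case: t szt st nTy pt ut nt => [|p1 [|p2 [|p3 [|p4 t]]]];
  try by move=> /= szt; exfalso; lia.
move=> szt _ nTy pt ut nt.
pose qs := take j t.
have szq : size qs = j by rewrite size_takel // /j; move: szt => /=; lia.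
have sub : subseq [:: p1, p2, p3, p4 & qs] [:: p1, p2, p3, p4 & t].
  exact: (cat_subseq (subseq_refl [:: p1; p2; p3; p4]) (take_subseq t j)).
have {}nTy p : p \in [:: p1, p2, p3, p4 & qs] -> edge_col col p \notin Ty.
  by move/(mem_subseq sub); exact: nTy.
have {}nt p : p \in [:: p1, p2, p3, p4 & qs] -> p.1 != p.2.
  by move/(mem_subseq sub); exact: nt.
have {}pt := subseq_pairwise sub pt.
have {}ut := subseq_uniq (map_subseq _ sub) ut.
move: (qs) szq {sub szt} nTy nt pt ut => {qs}qs szq nTy nt pt ut.
have qsub p : p \in qs -> p \in [:: p1, p2, p3, p4 & qs].
  by rewrite !in_cons => ->; rewrite !orbT.
(* The four extra vertices realise all four cross colours. *)
pose K := [:: (p1, true); (p2, false); (p3, false); (p4, true)].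
pose E := K ++ [seq (q, true) | q <- qs] ++ [seq (q, false) | q <- qs].
have memE p b : (p, b) \in E -> (p \in qs) || ((p, b) \in K).
  rewrite !mem_cat => /orP[->|]; first by rewrite orbT.
  by case/orP => /mapP[q qq [-> _]]; rewrite qq.
have Eq q b : q \in qs -> (q, b) \in E.
  by move=> qq; rewrite !mem_cat; case: b; rewrite map_f ?orbT.
have memP p b : (p, b) \in E -> p \in [:: p1, p2, p3, p4 & qs].
  case/memE/orP => [/qsub //|]; rewrite !inE !xpair_eqE.
  by case/or4P => /andP[-> _]; rewrite ?orbT.
have uP := map_uniq ut.
(* Only the pairs in [qs] have both endpoints selected, so no other pair contributes its own
   colour. *)
have both p : (p, true) \in E -> (p, false) \in E -> p \in qs.
  case/memE/orP => // + /memE/orP[//|];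
    rewrite !inE !xpair_eqE /= !andbT !andbF !orbF /=.
  case/orP => /eqP -> /orP[] /eqP E1; move: uP;
    by rewrite E1 /= !in_cons ?eqxx ?orbT //= ?andbF.
exists (map vtx E), (U ++ map (edge_col col) qs); split.
- rewrite cat_uniq uU /=; apply/andP; split; last first.
    by move: ut => /= /and5P[_ _ _ _].
  apply/hasPn => d /mapP[q qq ->]; rewrite /= memU.
  by apply: nTy; exact: qsub.
- by rewrite size_cat size_map szq /j subnKC // (leq_trans szU).
have crossE p q b b' : p \in [:: p1, p2, p3, p4 & qs] ->
    q \in [:: p1, p2, p3, p4 & qs] -> p != q ->
    col (vtx (p, b)) (vtx (q, b')) \in Ty.
  move=> pP qP pq; case/orP: (pairwise_mem pt pP qP pq) => /forallP H.
    have /forallP/(_ b')/andP[_ /eqP ->] := H b.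
    by rewrite !inE; case: b b' => -[]; rewrite eqxx ?orbT.
  have /forallP/(_ b)/andP[_ /eqP] := H b'; rewrite colC => ->.
  by rewrite !inE; case: b b' => -[]; rewrite eqxx ?orbT.
move=> d; rewrite mem_cat memU; split.
  case/orP => [|/mapP[q qq ->]]; last first.
    exists q.1, q.2; split=> //; last by apply: nt; exact: qsub.
      by rewrite -[q.1]/(vtx (q, true)) map_f ?Eq.
    by rewrite -[q.2]/(vtx (q, false)) map_f ?Eq.
  have [H1 H2 H3 H4] : [/\ (p1, true) \in E, (p2, false) \in E, (p3, false) \in
    E & (p4, true) \in E].
    by rewrite !mem_cat !inE !eqxx !orbT.
  have key p b q b' : (p, b) \in E -> (q, b') \in E ->
      [forall b, forall b', (vtx (p, b) != vtx (q, b')) &&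
        (col (vtx (p, b)) (vtx (q, b')) ==
        if b then (if b' then al else be) else (if b' then ga else de))] ->
      exists x y, [/\ x \in map vtx E, y \in map vtx E, x != y
        & col x y = if b then (if b' then al else be) else (if b' then ga else
          de)].
    move=> pE qE /forallP/(_ b)/forallP/(_ b')/andP[xy /eqP cxy].
    by exists (vtx (p, b)), (vtx (q, b')); rewrite !map_f.
  move: pt => /= /and4P[/and4P[P12 P13 P14 _] /and3P[P23 P24 _] _ _].
  (* The colours [al], [be], [ga], [de] occur between [p1] and [p4], [p1] and [p2], [p2] and [p4],
     [p2] and [p3] respectively. *)
  rewrite !inE => /or4P[] /eqP ->.
  - exact: key H1 H4 P14.
  - exact: key H1 H2 P12.
  - exact: key H2 H4 P24.
  - exact: key H2 H3 P23.
case=> x [y [/mapP[[p b] pE ->] /mapP[[q b'] qE ->] xy <-]].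
case: (eqVneq p q) => [pq|pq]; last first.
  by rewrite crossE ?(memP _ _ pE) ?(memP _ _ qE).
apply/orP; right; rewrite -{q}pq in qE xy *.
have pq : p \in qs.
  by case: b b' pE qE xy => -[] pE qE; rewrite ?eqxx // => _; exact: both.
have -> : col (vtx (p, b)) (vtx (p, b')) = edge_col col p.
  by case: b b' xy {pE qE} => -[]; rewrite ?eqxx.
exact: map_f.
Qed.

(** A cross entry 0 would put one endpoint of the head [z] on all later edges, against
    [no_common_vertex]; so all four entries are successors. *)
Lemma matching_spans (m N : nat) : 3 < m -> exists M, forall (T : eqType)
    (col : T -> T -> nat) (ps : seq (T * T)), commutative col ->
  (forall v xs, v \notin xs -> uniq (map (col v) xs) -> size xs <= N) ->
  M <= size ps -> {in ps, forall p, p.1 != p.2} ->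
  uniq (map (edge_col col) ps) -> spans_exactly col m.
Proof.
move=> m3; have [M HM] := homogeneous_matching (N + m + 9) N.
exists M => T col ps colC bound szps nps ups.
have [s [[[al be] [ga de]] [ss szs ps']]] := HM T col ps colC bound szps.
have ns p : p \in s -> p.1 != p.2 by move=> ?; apply: nps;
  exact: mem_subseq ss _ _.
have {ups}us := subseq_uniq (map_subseq _ ss) ups.
have szs' : m + 8 <= size s by rewrite szs; lia.
case: s szs ps' ns us szs' {ss} => [|z s szs ps' ns us]; first by rewrite addnS.
have /andP[/allP zs _] := ps'.
have sub : {subset s <= z :: s} by move=> p; rewrite in_cons orbC => ->.
have szs1 : N < size s by move: szs => /=; lia.
have us1 : uniq (map (edge_col col) s) by move: us => /= /andP[].
have ns1 p : p \in s -> p.1 != p.2 by move/sub/ns.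
have ns2 p : p \in s -> p.2 != p.1 by rewrite eq_sym; exact: ns1.
have e1 p : p \in s -> col p.1 p.2 = edge_col col p by [].
have e2 p : p \in s -> col p.2 p.1 = edge_col col p by rewrite colC.
have noc f g v := @no_common_vertex T col N v f g s bound.
have ecol0 x y : ecol col x y = 0 -> y = x.
  by rewrite /ecol; case: eqP => // ->.
case: al ps' zs => [|al] ps' zs.
  case: (noc fst snd z.1 ns1 e1 us1 szs1) => p /zs/eqP[E _ _ _].
  exact: ecol0.
case: be ps' zs => [|be] ps' zs.
  case: (noc snd fst z.1 ns2 e2 us1 szs1) => p /zs/eqP[_ E _ _].
  exact: ecol0.
case: ga ps' zs => [|ga] ps' zs.
  case: (noc fst snd z.2 ns1 e1 us1 szs1) => p /zs/eqP[_ _ E _].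
  exact: ecol0.
case: de ps' zs => [|de] ps' zs.
  case: (noc snd fst z.2 ns2 e2 us1 szs1) => p /zs/eqP[_ _ _ E].
  exact: ecol0.
by move=> szs'; apply: homogeneous_matching_spans szs' us ns ps'.
Qed.

(** * Twin vertices and the combination of the cases *)

Lemma twin_pair (r k : nat) : exists N, forall (T : eqType)
    (col : T -> T -> nat) (R vs : seq T) (L : seq nat), commutative col ->
  size R = r -> size L = k -> (forall x y, x != y -> col x y \in L) ->
  uniq vs -> N <= size vs ->
  exists u u', [/\ u \notin R, u' \notin R, u != u'
    & {in R, forall x, col u x = col u' x}].
Proof.
have [N HN] := twins r k 2.
exists (N + r) => T col R vs L colC szR szL colL uvs szvs.
pose U := [seq x <- vs | x \notin R].
have szU : N <= size U.
  have : size [seq x <- vs | x \in R] <= size R.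
    by apply: uniq_leq_size => [|x];
      rewrite ?filter_uniq // mem_filter => /andP[].
  rewrite !size_filter.
  have := count_predC (mem R) vs.
  rewrite (eq_count (_ : predC _ =1 (fun x => x \notin R))) //.
  rewrite (eq_count (_ : mem R =1 (fun x => x \in R))) //.
  by lia.
have RU : {in R & U, forall x u, col x u \in L}.
  move=> x u xR; rewrite mem_filter => /andP[uR _]; apply: colL.
  by apply: contraNneq uR => <-.
have [[|u [|u' [|? ?]]] [sU' // _ cU']] := HN T col R U L szR szL szU RU.
have := subseq_uniq sU' (filter_uniq _ uvs); rewrite /= inE andbT => uu'.
have UR x : x \in [:: u; u'] -> x \notin R.
  by move/(mem_subseq sU'); rewrite mem_filter => /andP[].
exists u, u'; split=> //; rewrite ?UR ?inE ?eqxx ?orbT // => x xR.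
by rewrite colC (colC u'); apply: cU'; rewrite ?inE ?eqxx ?orbT.
Qed.

(** Take twins [u], [u'] over the endpoints of [p] and [q]. If an endpoint is joined to [u] in a
    colour other than [col u u'], it forms with the twins a triangle in two colours. Otherwise [u]
    is joined to all endpoints in one colour, and one of [p], [q] has another colour and closes such
    a triangle. *)
Lemma two_colours_span (k : nat) : exists D, forall (T : eqType)
    (col : T -> T -> nat) (p q : T * T) (vs : seq T) (L : seq nat),
  commutative col -> p.1 != p.2 -> q.1 != q.2 ->
  edge_col col p != edge_col col q -> size L = k ->
  (forall x y, x != y -> col x y \in L) -> uniq vs -> D <= size vs ->
  spans_exactly col 2.
Proof.
have [D HD] := twin_pair 4 k.
exists D => T col p q vs L colC np nq pq szL colL uvs szvs.
have [u [u' [uR u'R uu' twin]]] :=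
  HD T col [:: p.1; p.2; q.1; q.2] vs L colC erefl szL colL uvs szvs.
pose z := col u u'.
have spanE (a b c : T) (d : nat) : uniq [:: a; b; c] -> col a b != d ->
    col a c = d -> col b c = d -> spans_exactly col 2.
  move=> uabc abd ac bc; exists [:: a; b; c], [:: col a b; d]; split=> //.
    by rewrite /= inE abd.
  by move=> e; rewrite -mem_cols //= ac bc !inE; case: (e == _); case: (e == d).
have [|] := boolP (all (fun x => col u x == z) [:: p.1; p.2; q.1; q.2]);
  last first.
  case/allPn => x xR xz; apply: (spanE u u' x (col u x)).
  - rewrite /= !inE negb_or uu' /= andbT; apply/andP; split.
      by apply: contraNneq uR => ->.
    by apply: contraNneq u'R => ->.
  - by rewrite eq_sym.
  - by [].
  - by rewrite twin.
move=> /and5P[/eqP u1 /eqP u2 /eqP u3 /eqP u4 _].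
have uN x : x \in [:: p.1; p.2; q.1; q.2] -> x != u.
  by move=> xR; apply: contraNneq uR => <-.
have [pz|pz] := eqVneq (edge_col col p) z.
  apply: (spanE q.1 q.2 u z); rewrite 1?(colC _ u) //;
    last by rewrite eq_sym -pz.
  by rewrite /= !inE !negb_or nq !uN ?inE ?eqxx ?orbT.
apply: (spanE p.1 p.2 u z); rewrite 1?(colC _ u) //.
by rewrite /= !inE !negb_or np !uN ?inE ?eqxx ?orbT.
Qed.

(* [ps] lists one edge of each of the [k] colours, [L] lists the colours, and
   [vs] witnesses that there are at least [D] vertices. *)
Definition forces_span (m k D : nat) := forall (T : eqType)
    (col : T -> T -> nat) (ps : seq (T * T)) (vs : seq T) (L : seq nat),
  commutative col -> {in ps, forall p, p.1 != p.2} ->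
  uniq (map (edge_col col) ps) -> size ps = k -> size L = k ->
  (forall x y, x != y -> col x y \in L) -> uniq vs -> D <= size vs ->
  spans_exactly col m.

(** [C] provides enough edges of distinct colours when all stars have few colours; [D], which
    depends on [k], provides the twins when some star has many. *)
Lemma many_colours_span (n : nat) : 1 < n ->
  exists C, forall k, C <= k -> exists D, forces_span ('C(n.+1, 2) + 1) k D.
Proof.
move=> n1; set m := _ + 1.
have m3 : 3 < m.
  by rewrite /m addn1 ltnS -[3]/('C(3, 2)) leq_bin2l.
have [r Hr] := rainbow_clique_spans n.
have [N HN] := star_spans r (ltnW m3).
have [C HC] := matching_spans N m3.
exists C => k Ck; have [D HD] := twin_pair r k.
exists D => T col ps vs L colC nps ups szps szL colL uvs szvs.
have [[v [xs [vxs uxs szxs]]]|nostar] := pselect (exists v xs,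
    [/\ v \notin xs, uniq (map (col v) xs) & N < size xs]); last first.
  apply: (HC T col ps) => //; last by rewrite szps.
  move=> v xs vxs uxs; rewrite leqNgt; apply/negP => szxs.
  by apply: nostar; exists v, xs.
case: (HN T col v xs colC (ltnW szxs) vxs uxs) => // -[R [szR uR ucR]].
have [u [u' [uNR u'NR uu' twin]]] := HD T col R vs L colC szR szL colL uvs szvs.
by apply: (Hr T col R u u'); rewrite ?szR.
Qed.

(** * From lists back to sets and cardinals *)

Local Open Scope classical_set_scope.
Local Open Scope card_scope.

(** [{classic V}] equips the bare type [V] with the equality test that the list lemmas require. *)
Definition pair_col (V : Type) (c : set V -> nat) (x y : {classic V}) : nat :=
  c [set x; y].

Lemma pair_colC (V : Type) (c : set V -> nat) : commutative (pair_col c).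
Proof. by move=> x y; rewrite /pair_col setUC. Qed.

Lemma edgesP (V : Type) (X e : set {classic V}) :
  edges X e <-> exists x y, [/\ X x, X y, x != y & e = [set x; y]].
Proof.
split.
  case=> eX /card_set_bijP[f [ff fi fs]].
  have [x ex fx] : (f @` e) 0 by exact: fs.
  have [y ey fy] : (f @` e) 1 by exact: fs.
  exists x, y; split; [exact: eX | exact: eX | |].
    by apply: contra_eq_neq fx => ->; rewrite fy.
  apply/seteqP; split=> z /=; last by case=> ->.
  move=> ez; have := ff z ez; rewrite /= => /ltnSE.
  rewrite leq_eqVlt ltnS leqn0 => /orP[] /eqP fz; [right|left].
    by apply: fi; rewrite ?inE // fz fy.
  by apply: fi; rewrite ?inE // fz fx.
case=> x [y [Xx Xy xy ->]]; split; first by move=> z [] ->.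
apply/card_set_bijP; exists (fun z => (z == y) : nat); split.
- by move=> z _ /=; case: (_ == _).
- move=> a b; rewrite !inE /= => -[] -> [] ->; rewrite ?eqxx ?(negPf xy) //.
- case=> [|[|//]] _; [exists x; rewrite ?(negPf xy) | exists y;
    rewrite ?eqxx] => //=.
  + by left.
  + by right.
Qed.

Lemma uniq_seq_card (L : seq nat) :
  uniq L -> [set d | d \in L] #= `I_(size L).
Proof.
move=> uL; apply/card_set_bijP; exists (fun d => index d L); split.
- by move=> d /= dL; rewrite index_mem.
- move=> a b; rewrite !inE /= => aL bL E.
  by rewrite -(nth_index 0 aL) E nth_index.
- move=> i /= iL; exists (nth 0 L i); first exact: mem_nth.
  by rewrite index_uniq.
Qed.

Lemma card_uniq_seq (A : set nat) (k : nat) : A #= `I_k ->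
  exists L : seq nat, [/\ uniq L, size L = k & forall d, d \in L <-> A d].
Proof.
rewrite card_eq_sym => /card_set_bijP[f [ff fi fs]].
exists (map f (iota 0 k)); split; rewrite ?size_map ?size_iota //.
  rewrite map_inj_in_uniq ?iota_uniq // => i j;
    rewrite !mem_iota !add0n /= => ik jk.
  by apply: fi; rewrite inE.
move=> d; split=> [/mapP[i]|/fs[i ik <-]].
  by rewrite mem_iota add0n => ik ->; exact: ff.
by rewrite map_f // mem_iota add0n.
Qed.

Lemma card_le_uniq_seq (V : Type) (D : nat) : `I_D #<= [set: V] ->
  exists vs : seq {classic V}, uniq vs /\ size vs = D.
Proof.
move=> /card_leP[f].
pose g (i : 'I_D) : {classic V} :=
  set_val (f (SigSub (mem_set (ltn_ord i : `I_D i)))).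
exists (map g (enum 'I_D)); rewrite size_map size_enum_ord; split=> //.
rewrite map_inj_uniq ?enum_uniq // => i j /val_inj E.
by apply/val_inj; have [] := inj (mem_set I) (mem_set I) E.
Qed.

Lemma spans_uses_exactly (V : Type) (c : set V -> nat) (m : nat) :
  spans_exactly (pair_col c) m -> exists X : set V, uses_exactly c X m.
Proof.
case=> s [L [uL szL LE]]; exists [set x : {classic V} | x \in s].
rewrite /uses_exactly -szL.
have -> : c @` edges [set x : {classic V} | x \in s] = [set d | d \in L].
  apply/seteqP; split=> d /=.
    by case=> e /edgesP[x [y [xs ys xy ->]]] <-; apply/LE; exists x, y.
  case/LE => x [y [xs ys xy <-]]; exists [set x; y] => //.
  by apply/edgesP; exists x, y.
exact: uniq_seq_card.
Qed.

Lemma edge_representatives (V : Type) (c : set V -> nat) (L : seq nat) :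
  (forall d, d \in L -> (c @` edges [set: V]) d) ->
  exists ps : seq ({classic V} * {classic V}),
    {in ps, forall p, p.1 != p.2} /\ map (edge_col (pair_col c)) ps = L.
Proof.
elim: L => [|d L IHL] dL; first by exists [::].
case: IHL => [e eL|ps [nps psL]]; first by apply: dL; rewrite in_cons eL orbT.
have [e /edgesP[x [y [_ _ xy ->]]] <-] := dL d (mem_head _ _).
exists ((x, y) :: ps); split; last by rewrite /= psL.
by move=> p; rewrite in_cons => /predU1P[->|/nps].
Qed.

Theorem theorem9 (n : nat) :
  exists C2 : nat, forall k : nat, (C2 <= k)%N ->
  exists D : nat, forall V : Type,
    countable [set: V] -> `I_D #<= [set: V] -> F V k ('C(n, 2) + 1)%N.
Proof.
suff [C HC] : exists C, forall k, C <= k -> exists D,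
    forces_span ('C(n, 2) + 1) k D.
  exists C => k /HC[D HD]; exists D => V _ /card_le_uniq_seq[vs [uvs szvs]] c.
  case/card_uniq_seq => L [uL szL LE].
  have [ps [nps psL]] := @edge_representatives V c L (fun d => (LE d).1).
  apply/spans_uses_exactly/(HD _ _ ps vs L) => //.
  - exact: pair_colC.
  - by rewrite psL.
  - by rewrite -szL -psL size_map.
  - move=> x y xy; apply/LE; exists [set x; y] => //.
    by apply/edgesP; exists x, y.
  - by rewrite szvs.
(* For [n] equal to 0 or 1 the binomial coefficient vanishes and a single edge suffices; [n = 2]
   asks for two colours. *)
have one : exists C, forall k, C <= k -> exists D, forces_span 1 k D.
  exists 1 => k k0; exists 0 => T col [|p ps] vs L colC nps _ szps.
    by rewrite -szps in k0.
  have np := nps p (mem_head _ _).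
  exists [:: p.1; p.2], [:: edge_col col p]; split=> // d.
  by rewrite -mem_cols //= inE np.
case: n => [|[|[|n]]] //; last exact: many_colours_span.
exists 2 => k k2; have [D HD] := two_colours_span k.
exists D => T col [|p [|q ps]] vs L colC nps ups szps szL colL uvs szvs;
  try by rewrite -szps in k2.
apply: (HD T col p q vs L) => //; try by apply: nps; rewrite !inE eqxx ?orbT.
by move: ups => /= /andP[]; rewrite inE negb_or => /andP[].
Qed.
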